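(* Let $i\in\{1,2\}$, and suppose that the linearly independent system $\{p_{ki}\}_{k=0}^{\nu}$ and the orthogonal system $\{\Pi_{ki}\}_{k=0}^{\nu}$ span the same subspace of $\mathbb{E}_i$. Let $\rho_k^i=\|\Pi_{ki}\|_i^2$ for $k=0,\dots,\nu$. Then the estimations GFMB and IFB-GFMB (defined in the context) are equivalent.
   Context: For $i=0,1,2$, $\mathbb{E}_i$ is a Euclidean (real inner product) space of functions $\varphi:D_i\to\mathbf{R}$, $D_i\subset\mathbf{R}$, with scalar product $\langle\cdot,\cdot\rangle_i$ and norm $\|\cdot\|_i$, containing the constant function $\Pi_{0i}\equiv1$ and such that: (P1) if $\varphi,\psi\in\mathbb{E}_i$ then $\varphi\psi\in\mathbb{E}_i$ and $\langle\varphi,\psi\rangle_i=\langle\Pi_{0i},\varphi\psi\rangle_i$; (P2) if $\varphi\in\mathbb{E}_i$ and $\varphi(t)\ge0$ for all $t\in D_i$, then $\langle\Pi_{0i},\varphi\rangle_i\ge0$. Moreover $D_1\cap D_2=\emptyset$, $D_1\cup D_2=D_0$, restrictions to $D_i$ ($i=1,2$) of elements of $\mathbb{E}_0$ belong to $\mathbb{E}_i$, and $\langle\varphi,\psi\rangle_0=\langle\varphi_1,\psi_1\rangle_1+\langle\varphi_2,\psi_2\rangle_2$, where the subscript $i$ on a function denotes its restriction to $D_i$. $\nu\ge0$ and $n\ge1$ are integers, $M_1=(\nu+1)n$, $M_2=2M_1$. $\Pi_{0i},\dots,\Pi_{\nu i}$ is an orthogonal system (of nonzero elements) in $\mathbb{E}_i$;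 $p_{0i},\dots,p_{\nu i}\in\mathbb{E}_i$ are linearly independent, and $\gamma_{kl}=\langle p_{ki},p_{li}\rangle_i$. $f\in\mathbb{E}_0^n$, $f_i$ is its restriction to $D_i$, and $\langle f_i,\varphi\rangle_i\in\mathbf{R}^n$ is taken componentwise for $\varphi\in\mathbb{E}_i$. $W\in\mathbf{R}^{n\times n}$ is symmetric positive definite. $\mathrm{He}(A)=A+A^T$. Both estimations use free matrices $Z_{kl}^i\in\mathbf{R}^{M_2\times M_2}$, $N_k^i\in\mathbf{R}^{M_2\times n}$ ($k,l=0,\dots,\nu$) such that the symmetric matrix $$\Psi^i=\begin{bmatrix} Z_{00}^i&\cdots&Z_{0\nu}^i&N_0^i\\ \vdots&\ddots&\vdots&\vdots\\ Z_{\nu0}^i&\cdots&Z_{\nu\nu}^i&N_\nu^i\\ (N_0^i)^T&\cdots&(N_\nu^i)^T&W\end{bmatrix}$$ satisfies $\Psi^i\ge0$ (positive semidefinite), and an arbitrary vector $\chi_i\in\mathbf{R}^{M_2}$. GFMB (generalized free-matrix-based inequality): if $\Psi^i\ge0$, then $$\langle f_i,Wf_i\rangle_i\ \ge\ -\chi_i^T\Big(\sum_{k=0}^\nu\rho_k^iZ_{kk}^i\Big)\chi_i-\sum_{k=0}^\nu\mathrm{He}\big(\chi_i^TN_k^i\langle f_i,\Pi_{ki}\rangle_i\big).$$ IFB-GFMB (independent-functions-based GFMB inequality): if $\Psi^i\ge0$, then $$\langle f_i,Wf_i\rangle_i\ \ge\ -\sum_{k=0}^\nu\mathrm{He}\big(\chi_i^TN_k^i\langle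 f_i,p_{ki}\rangle_i\big)-\chi_i^T\Big(\sum_{k=0}^\nu\gamma_{kk}Z_{kk}^i+\sum_{k=0}^\nu\sum_{l=k+1}^\nu\mathrm{He}(\gamma_{kl}Z_{kl}^i)\Big)\chi_i .$$ ''Equivalent'' is used without a formal definition; it refers to the lower estimations obtainable by choosing the free parameters (in particular, IFB-GFMB, although it contains more free parameters, does not give a better lower estimation than GFMB). *)

(* Defs.v *)
From HB Require Import structures.
From mathcomp Require Import all_boot all_order all_algebra.
From mathcomp Require Import boolp classical_sets functions reals.

Set Implicit Arguments.
Unset Strict Implicit.
Unset Printing Implicit Defensive.
Import Order.TTheory GRing.Theory Num.Theory.
Local Open Scope classical_set_scope.
Local Open Scope ring_scope.

(* A set D coerces to the subtype {t | t \in D}, so [D -> R] is the type of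
   functions defined on D only and its equality is pointwise equality on D.
   The value of [ip] on functions outside [carrier] is irrelevant. *)
Record euclidean_function_space (R : realType) (D : set R) :=
  EuclideanFunctionSpace {
    carrier : set (D -> R);
    ip : (D -> R) -> (D -> R) -> R;
    carrier_cst1 : carrier (cst 1);
    carrier_linear : forall (a : R) (phi psi : D -> R),
      carrier phi -> carrier psi -> carrier (a \*o phi + psi);
    ip_sym : forall phi psi : D -> R,
      carrier phi -> carrier psi -> ip phi psi = ip psi phi;
    ip_linear : forall (a : R) (phi psi eta : D -> R),
      carrier phi -> carrier psi -> carrier eta ->
      ip (a \*o phi + psi) eta = a * ip phi eta + ip psi eta;
    ip_posdef : forall phi : D -> R,
      carrier phi -> phi <> 0 -> 0 < ip phi phi;
    carrier_mul : forall phi psi : D -> R,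
      carrier phi -> carrier psi -> carrier (phi \* psi);
    ip_mul : forall phi psi : D -> R,
      carrier phi -> carrier psi -> ip phi psi = ip (cst 1) (phi \* psi);
    ip_ge0 : forall phi : D -> R,
      carrier phi -> (forall t : D, 0 <= phi t) -> 0 <= ip (cst 1) phi }.

Definition ip_norm (R : realType) (D : set R)
    (E : euclidean_function_space D) (phi : D -> R) : R :=
  Num.sqrt (ip E phi phi).

Definition restrict_fun (R : realType) (A B : set R) (AB : A `<=` B)
    (phi : B -> R) : A -> R :=
  fun t => phi (exist _ (val t) (mem_set (AB _ (set_mem (valP t))))).

Lemma dom_sub (R : realType) (D : 'I_3 -> set R) (hD : D 1 `|` D 2 = D 0)
  (i : 'I_3) : D i `<=` D 0.
Proof.
have [->|[->|->]] : i = 0 \/ i = 1 \/ i = 2.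
- by case: i => [[|[|[|//]]] hi];
    [left | right; left | right; right]; exact: val_inj.
- exact: subset_refl.
- by rewrite -hD; exact: subsetUl.
- by rewrite -hD; exact: subsetUr.
Qed.

Definition lin_indep (R : realType) (D : set R) (m : nat)
    (p : 'I_m -> D -> R) : Prop :=
  forall c : 'I_m -> R, \sum_k (c k \*o p k) = 0 -> forall k, c k = 0.

Definition lin_span (R : realType) (D : set R) (m : nat)
    (p : 'I_m -> D -> R) : set (D -> R) :=
  [set phi | exists c : 'I_m -> R, phi = \sum_k (c k \*o p k)].

Definition orthogonal_system (R : realType) (D : set R)
    (E : euclidean_function_space D) (m : nat) (Pi : 'I_m -> D -> R) : Prop :=
  (forall k, Pi k <> 0) /\ (forall k l, k != l -> ip E (Pi k) (Pi l) = 0).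

Definition He (R : realType) (m : nat) (A : 'M[R]_m) : 'M[R]_m := A + A^T.

Definition pos_semidef (R : realType) (m : nat) (A : 'M[R]_m) : Prop :=
  A^T = A /\ forall x : 'cV[R]_m, 0 <= (x^T *m A *m x) 0 0.

Definition pos_def (R : realType) (m : nat) (A : 'M[R]_m) : Prop :=
  A^T = A /\ forall x : 'cV[R]_m, x != 0 -> 0 < (x^T *m A *m x) 0 0.

Definition M1 (nu n : nat) : nat := (nu.+1 * n)%N.
Definition M2 (nu n : nat) : nat := (2 * M1 nu n)%N.

Record free_matrices (R : realType) (nu n : nat) := FreeMatrices {
  Zm : 'I_nu.+1 -> 'I_nu.+1 -> 'M[R]_(M2 nu n);
  Nm : 'I_nu.+1 -> 'M[R]_(M2 nu n, n) }.

Definition Psi (R : realType) (nu n : nat) (W : 'M[R]_n)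
    (P : free_matrices R nu n) : 'M[R]_(\sum_(k < nu.+1) M2 nu n + n) :=
  block_mx (\mxblock_(k < nu.+1, l < nu.+1) Zm P k l)
           (\mxcol_(k < nu.+1) Nm P k)
           (\mxrow_(k < nu.+1) (Nm P k)^T)
           W.

(* f : 'I_n -> D -> R lists the components of an element of E^n. *)
Definition vec_ip (R : realType) (D : set R) (E : euclidean_function_space D)
    (n : nat) (f : 'I_n -> D -> R) (phi : D -> R) : 'cV[R]_n :=
  \col_j ip E (f j) phi.

(* <f, W f>, with the scalar product of E^n summed over components. *)
Definition weighted_sqnorm (R : realType) (D : set R)
    (E : euclidean_function_space D) (n : nat) (W : 'M[R]_n)
    (f : 'I_n -> D -> R) : R :=
  \sum_j ip E (f j) (\sum_k (W j k \*o f k)).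

Definition gfmb_bound (R : realType) (D : set R)
    (E : euclidean_function_space D) (nu n : nat)
    (Pi : 'I_nu.+1 -> D -> R) (rho : 'I_nu.+1 -> R)
    (P : free_matrices R nu n) (f : 'I_n -> D -> R)
    (chi : 'cV[R]_(M2 nu n)) : R :=
  (- (chi^T *m (\sum_k rho k *: Zm P k k) *m chi)
   - \sum_k He (chi^T *m Nm P k *m vec_ip E f (Pi k))) 0 0.

Definition ifb_gfmb_bound (R : realType) (D : set R)
    (E : euclidean_function_space D) (nu n : nat)
    (p : 'I_nu.+1 -> D -> R) (gamma : 'I_nu.+1 -> 'I_nu.+1 -> R)
    (P : free_matrices R nu n) (f : 'I_n -> D -> R)
    (chi : 'cV[R]_(M2 nu n)) : R :=
  (- (\sum_k He (chi^T *m Nm P k *m vec_ip E f (p k)))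
   - chi^T *m (\sum_k gamma k k *: Zm P k k
               + \sum_(k < nu.+1) \sum_(l < nu.+1 | (k < l)%N)
                   He (gamma k l *: Zm P k l))
     *m chi) 0 0.

(* Below, b is the right-hand side of an estimation, as a function of the free
   matrices, of f and of chi, and S is the set of f to be estimated. *)

Definition lower_estimation (R : realType) (D : set R)
    (E : euclidean_function_space D) (nu n : nat) (W : 'M[R]_n)
    (S : set ('I_n -> D -> R))
    (b : free_matrices R nu n -> ('I_n -> D -> R) -> 'cV[R]_(M2 nu n) -> R)
    : Prop :=
  forall P, pos_semidef (Psi W P) ->
  forall f chi, S f -> b P f chi <= weighted_sqnorm E W f.

(* Every lower bound obtainable from b by an admissible choice of the free
   matrices is obtainable from b'; the choice made for b' may depend neither
   on f nor on chi. *)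
Definition obtainable_from (R : realType) (D : set R) (nu n : nat)
    (W : 'M[R]_n) (S : set ('I_n -> D -> R))
    (b b' : free_matrices R nu n -> ('I_n -> D -> R) -> 'cV[R]_(M2 nu n) -> R)
    : Prop :=
  forall P, pos_semidef (Psi W P) ->
  exists P', pos_semidef (Psi W P') /\
    forall f chi, S f -> b' P' f chi = b P f chi.

Definition equivalent_estimations (R : realType) (D : set R) (nu n : nat)
    (W : 'M[R]_n) (S : set ('I_n -> D -> R))
    (b b' : free_matrices R nu n -> ('I_n -> D -> R) -> 'cV[R]_(M2 nu n) -> R)
    : Prop :=
  obtainable_from W S b b' /\ obtainable_from W S b' b.

Definition restrictions (R : realType) (A B : set R) (AB : A `<=` B)
    (E : euclidean_function_space B) (n : nat) : set ('I_n -> A -> R) :=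
  [set g | exists f : 'I_n -> B -> R,
     (forall j, carrier E (f j)) /\ g = fun j => restrict_fun AB (f j)].

(* Main.v *)
(* Both estimations are instances, for q = Pi and q = p, of the single estimation
   <f, W f> >= - \sum_(k, l) <q_k, q_l> chi^T Z_kl chi
               - 2 \sum_k chi^T N_k <f, q_k>,
   which is (P2) applied to the pointwise nonnegative function y^T Psi y with
   y(t) = (q_0(t) chi, ..., q_nu(t) chi, f(t)). If q = C p for a matrix C of
   constants, the bound given by Psi for q is the bound for p given by
   T^T Psi T with T = diag(C (x) I, I), and this congruence preserves positive
   semidefiniteness. As p and Pi span the same space, each of them is such a
   linear image of the other. *)
Require Import Defs.
From HB Require Import structures.
From mathcomp Require Import all_boot all_order all_algebra.
From mathcomp Require Import boolp classical_sets functions reals.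
From mathcomp Require Import ring lra.
Set Implicit Arguments.
Unset Strict Implicit.
Unset Printing Implicit Defensive.
Import Order.TTheory GRing.Theory Num.Theory.
Local Open Scope classical_set_scope.
Local Open Scope ring_scope.

(** * Finite linear combinations and Gram sums in a function space *)

Section EuclideanFunctionSpace.
Context {R : realType} {D : set R} (E : euclidean_function_space D).

(** Closure is only given for [a \*o phi + psi] and membership only for the constant 1, so 0 is
    obtained as (-1) 1 + 1. *)
Lemma carrier0 : carrier E 0.
Proof.
have := carrier_linear (-1) (carrier_cst1 E) (carrier_cst1 E).
by congr carrier; apply/funext => t; rewrite !fctE /= mulr1 addNr.
Qed.

Lemma ip0l eta : carrier E eta -> ip E 0 eta = 0.
Proof.
move=> Eeta; have := ip_linear (-1) carrier0 carrier0 Eeta.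
rewrite mulN1r addNr => <-.
by congr ip; apply/funext => t; rewrite !fctE /= mulr0 addr0.
Qed.

Lemma lin_combS (I : Type) (i : I) (r : seq I) (c : I -> R) (q : I -> D -> R) :
  \sum_(k <- i :: r) (c k \*o q k) = c i \*o q i + \sum_(k <- r) (c k \*o q k).
Proof. by rewrite big_cons. Qed.

Lemma carrier_lin_comb (I : Type) (r : seq I) (c : I -> R) (q : I -> D -> R) :
  (forall k, carrier E (q k)) -> carrier E (\sum_(k <- r) (c k \*o q k)).
Proof.
move=> Eq; elim: r => [|k r IHr]; first by rewrite big_nil; exact: carrier0.
by rewrite lin_combS; apply: carrier_linear.
Qed.

Lemma ip_lin_combl (I : Type) (r : seq I) (c : I -> R) (q : I -> D -> R) eta :
  (forall k, carrier E (q k)) -> carrier E eta ->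
  ip E (\sum_(k <- r) (c k \*o q k)) eta = \sum_(k <- r) c k * ip E (q k) eta.
Proof.
move=> Eq Eeta; elim: r => [|k r IHr]; first by rewrite !big_nil ip0l.
rewrite lin_combS big_cons -IHr ip_linear //.
exact: carrier_lin_comb.
Qed.

Lemma ip_lin_combr (I : Type) (r : seq I) (c : I -> R) (q : I -> D -> R) eta :
  (forall k, carrier E (q k)) -> carrier E eta ->
  ip E eta (\sum_(k <- r) (c k \*o q k)) = \sum_(k <- r) c k * ip E eta (q k).
Proof.
move=> Eq Eeta; have Ec := carrier_lin_comb r c Eq.
rewrite ip_sym // ip_lin_combl //; apply: eq_bigr => k _.
by rewrite ip_sym.
Qed.

Lemma quad_formE m (A : 'M[R]_m) (x : 'cV[R]_m) :
  (x^T *m A *m x) 0 0 = \sum_a \sum_b A a b * (x a 0 * x b 0).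
Proof.
rewrite !mxE exchange_big /=; apply: eq_bigr => b _.
rewrite !mxE mulr_suml; apply: eq_bigr => a _.
by rewrite !mxE mulrCA mulrA.
Qed.

(* By (P1) the sum is <1, x^T A x>, and the function x^T A x is nonnegative
   pointwise, so that (P2) applies. *)
Lemma psd_gram_ge0 m (A : 'M[R]_m) (x : 'I_m -> D -> R) :
  pos_semidef A -> (forall a, carrier E (x a)) ->
  0 <= \sum_a \sum_b A a b * ip E (x a) (x b).
Proof.
move=> [_ A_ge0] Ex.
(* Indexing by pairs turns the double sum into a single linear combination. *)
pose c (ab : 'I_m * 'I_m) := A ab.1 ab.2.
pose q (ab : 'I_m * 'I_m) : D -> R := x ab.1 \* x ab.2.
have Eq ab : carrier E (q ab) by exact: carrier_mul.
rewrite pair_big /=.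
have -> : \sum_ab A ab.1 ab.2 * ip E (x ab.1) (x ab.2)
        = \sum_ab c ab * ip E (cst 1) (q ab).
  by apply: eq_bigr => ab _; rewrite ip_mul.
rewrite -ip_lin_combr //; last exact: carrier_cst1.
apply: ip_ge0; first exact: carrier_lin_comb.
move=> t; rewrite fct_sumE.
have := A_ge0 (\col_a x a t); rewrite quad_formE pair_big /=.
by under eq_bigr do rewrite !mxE.
Qed.

End EuclideanFunctionSpace.

(** * Congruences of the block matrix [Psi] *)

Lemma pos_semidef_congr (R : realType) m p (A : 'M[R]_m) (T : 'M[R]_(m, p)) :
  pos_semidef A -> pos_semidef (T^T *m A *m T).
Proof.
move=> [A_sym A_ge0]; split.
  by rewrite !trmx_mul trmxK A_sym mulmxA.
by move=> x; have := A_ge0 (T *m x); rewrite trmx_mul !mulmxA.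
Qed.

Section FreeMatrices.
Context {R : realType} {nu n : nat} (W : 'M[R]_n).
Implicit Types P : free_matrices R nu n.

(** Symmetry of [Psi], read block by block. It lets the terms with k < l of IFB-GFMB account for
    those with l < k. *)
Lemma pos_semidef_Psi_sym P : pos_semidef (Psi W P) ->
  forall k l, (Zm P k l)^T = Zm P l k.
Proof.
move=> [+ _] k l; rewrite /Psi tr_block_mx => /eq_block_mx [+ _ _ _].
by rewrite tr_mxblock => /eq_mxblockP /(_ l k).
Qed.

(* The free matrices belonging to p when P belongs to q and
   q k = \sum_j c k j * p j. *)
Definition recombine (c : 'I_nu.+1 -> 'I_nu.+1 -> R) P :=
  FreeMatrices
    (fun j m => \sum_k \sum_l (c k j * c l m) *: Zm P k l)
    (fun j => \sum_k c k j *: Nm P k).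

Lemma pos_semidef_recombine c P :
  pos_semidef (Psi W P) -> pos_semidef (Psi W (recombine c P)).
Proof.
(* [C] is the Kronecker product of (c k j) with the identity; the identity block of [T] leaves W
   unchanged. *)
pose C := \mxblock_(k < nu.+1, j < nu.+1) ((c k j)%:M : 'M[R]_(M2 nu n)).
pose T := block_mx C 0 0 (1%:M : 'M[R]_n).
move=> /(@pos_semidef_congr _ _ _ _ T); congr pos_semidef.
rewrite /T /Psi tr_block_mx !mulmx_block !trmx0 trmx1.
rewrite !mul0mx !mulmx0 !mul1mx !mulmx1 !addr0 !add0r.
rewrite /C tr_mxblock mul_mxblock mul_mxblock mul_mxblock_mxrow.
rewrite mul_mxrow_mxblock; congr block_mx.
- apply: eq_mxblock => j m; rewrite /= exchange_big /=.
  apply: eq_bigr => l _; rewrite mulmx_suml; apply: eq_bigr => k _.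
  by rewrite tr_scalar_mx mul_scalar_mx mul_mx_scalar scalerA mulrC.
- apply: eq_mxcol => j; apply: eq_bigr => k _.
  by rewrite tr_scalar_mx mul_scalar_mx.
- apply: eq_mxrow => j; rewrite linear_sum; apply: eq_bigr => k _.
  by rewrite mul_mx_scalar linearZ.
Qed.

(* The matrix of (x, z) |-> y^T Psi y with y = (x_0 chi, ..., x_nu chi, z). *)
Definition compress P (chi : 'cV[R]_(M2 nu n)) : 'M[R]_(nu.+1 + n) :=
  block_mx (\matrix_(k, l) (chi^T *m Zm P k l *m chi) 0 0)
           (\matrix_(k, j) (chi^T *m Nm P k) 0 j)
           (\matrix_(j, k) (chi^T *m Nm P k) 0 j)
           W.

(** With chi e_k^T as k-th block row of [C], the matrix [T] sends (x, z) to (x_0 chi, ..., x_nu chi,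
    z), so [compress P chi] is T^T Psi T. *)
Lemma pos_semidef_compress P chi :
  pos_semidef (Psi W P) -> pos_semidef (compress P chi).
Proof.
pose C := \mxcol_(k < nu.+1) (chi *m (delta_mx 0 k : 'rV[R]_nu.+1)).
pose T := block_mx C 0 0 (1%:M : 'M[R]_n).
move=> /(@pos_semidef_congr _ _ _ _ T); congr pos_semidef.
rewrite /T /Psi tr_block_mx !mulmx_block !trmx0 trmx1.
rewrite !mul0mx !mulmx0 !mul1mx !mulmx1 !addr0 !add0r.
rewrite /C tr_mxcol mul_mxrow_mxblock !mul_mxrow_mxcol.
(* A factor e_k on either side keeps one row or column, so each block sum below collapses to a
   single term. *)
have dl (k i : 'I_nu.+1) m (B : 'M[R]_(1, m)) j :
    ((delta_mx 0 k)^T *m B) i j = (i == k)%:R * B 0 j.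
  by rewrite mxE big_ord1 !mxE eqxx.
have dr (k i : 'I_nu.+1) m (B : 'M[R]_(m, 1)) j :
    (B *m (delta_mx 0 k)) j i = (i == k)%:R * B j 0.
  by rewrite mxE big_ord1 !mxE eqxx mulrC.
rewrite /compress; congr block_mx; apply/matrixP => a b; rewrite summxE [RHS]mxE.
- rewrite [LHS](bigD1 b) //= [X in _ + X]big1 ?addr0 => [|l nlb].
    rewrite mulmxA dr eqxx mul1r mulmx_suml summxE [LHS](bigD1 a) //=.
    rewrite [X in _ + X]big1 ?addr0 => [|k nka].
      by rewrite trmx_mul -!mulmxA dl eqxx mul1r mulmxA.
    by rewrite trmx_mul -!mulmxA dl eq_sym (negPf nka) mul0r.
  by rewrite mulmxA dr eq_sym (negPf nlb) mul0r.
- rewrite (bigD1 a) //= [X in _ + X]big1 ?addr0 => [|k nka].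
    by rewrite trmx_mul -!mulmxA dl eqxx mul1r.
  by rewrite trmx_mul -!mulmxA dl eq_sym (negPf nka) mul0r.
- rewrite (bigD1 b) //= [X in _ + X]big1 ?addr0 => [|k nkb].
    by rewrite mulmxA dr eqxx mul1r -[chi in LHS]trmxK -trmx_mul mxE.
  by rewrite mulmxA dr eq_sym (negPf nkb) mul0r.
Qed.

End FreeMatrices.

(** * Both right-hand sides as one Gram bound *)

Section GramBound.
Context {R : realType} {D : set R} (E : euclidean_function_space D).
Context {nu n : nat} (W : 'M[R]_n).
Implicit Types (P : free_matrices R nu n) (f : 'I_n -> D -> R).
Implicit Types (q : 'I_nu.+1 -> D -> R) (chi : 'cV[R]_(M2 nu n)).

Definition gram_bound q P f chi : R :=
  - (\sum_k \sum_l ip E (q k) (q l) * (chi^T *m Zm P k l *m chi) 0 0)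
  - (\sum_k (chi^T *m Nm P k *m vec_ip E f (q k)) 0 0) *+ 2.

Lemma He_sum_mx11 (I : finType) (A : I -> 'M[R]_1) :
  (\sum_k He (A k)) 0 0 = (\sum_k A k 0 0) *+ 2.
Proof.
by rewrite summxE -sumrMnl; apply: eq_bigr => k _; rewrite !mxE mulr2n.
Qed.

Lemma mx11_oppB (A B : 'M[R]_1) : (- A - B) 0 0 = - A 0 0 - B 0 0.
Proof. by rewrite !mxE. Qed.

Lemma quad_form_sum (I : finType) (c : I -> R)
    (Z : I -> 'M[R]_(M2 nu n)) chi :
  (chi^T *m (\sum_k c k *: Z k) *m chi) 0 0
  = \sum_k c k * (chi^T *m Z k *m chi) 0 0.
Proof.
rewrite mulmx_sumr mulmx_suml summxE; apply: eq_bigr => k _.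
by rewrite -scalemxAr -scalemxAl mxE.
Qed.

(** Orthogonality removes the off-diagonal Gram terms, and rho_k is the k-th diagonal one. *)
Lemma gfmb_bound_gram Pi rho P f chi :
  (forall k, carrier E (Pi k)) -> orthogonal_system E Pi ->
  (forall k, rho k = ip_norm E (Pi k) ^+ 2) ->
  gfmb_bound E Pi rho P f chi = gram_bound Pi P f chi.
Proof.
move=> EPi [Pi_neq0 Pi_orth] hrho; rewrite /gfmb_bound /gram_bound.
rewrite mx11_oppB He_sum_mx11; congr (- _ - _).
rewrite quad_form_sum; apply: eq_bigr => k _.
rewrite (bigD1 k) //= big1 ?addr0 => [|l nlk]; last first.
  by rewrite Pi_orth 1?eq_sym // mul0r.
by rewrite hrho sqr_sqrtr // ltW // ip_posdef.
Qed.

(** Each row splits at the diagonal; exchanging the two sums turns the part l < k into the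
    transposed upper part. *)
Lemma sum_diag_upper (V : nmodType) m (G : 'I_m -> 'I_m -> V) :
  \sum_k G k k + \sum_(k < m) \sum_(l < m | (k < l)%N) (G k l + G l k)
  = \sum_k \sum_l G k l.
Proof.
have split_row (k : 'I_m) : \sum_l G k l =
    G k k + \sum_(l < m | (k < l)%N) G k l + \sum_(l < m | (l < k)%N) G k l.
  rewrite (bigD1 k) //= -addrA; congr (_ + _).
  rewrite (bigID (fun l : 'I_m => (k < l)%N)) /=.
  congr (_ + _); apply: eq_bigl => l; rewrite -val_eqE /=; by case: ltngtP.
rewrite (eq_bigr _ (fun k _ => split_row k)) !big_split /= -addrA.
congr (_ + _).
under eq_bigr do rewrite big_split /=.
rewrite big_split /=; congr (_ + _).
by rewrite (exchange_big_dep xpredT).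
Qed.

(** Since gamma and the blocks Z are symmetric, He(gamma_kl Z_kl) = gamma_kl Z_kl + gamma_lk Z_lk.
    The symmetry of Z comes from [Psi] being positive semidefinite. *)
Lemma ifb_gfmb_bound_gram p gamma P f chi :
  pos_semidef (Psi W P) -> (forall k, carrier E (p k)) ->
  (forall k l, gamma k l = ip E (p k) (p l)) ->
  ifb_gfmb_bound E p gamma P f chi = gram_bound p P f chi.
Proof.
move=> /pos_semidef_Psi_sym Z_sym Ep hgamma.
rewrite /ifb_gfmb_bound /gram_bound.
rewrite mx11_oppB He_sum_mx11 addrC.
congr (- _ - _).
have -> : \sum_(k < nu.+1) \sum_(l < nu.+1 | (k < l)%N)
            He (gamma k l *: Zm P k l)
        = \sum_(k < nu.+1) \sum_(l < nu.+1 | (k < l)%N)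
            (gamma k l *: Zm P k l + gamma l k *: Zm P l k).
  apply: eq_bigr => k _; apply: eq_bigr => l _.
  by rewrite /He linearZ /= Z_sym !hgamma (ip_sym (Ep l)).
rewrite (sum_diag_upper (fun k l => gamma k l *: Zm P k l)).
rewrite mulmx_sumr mulmx_suml summxE; apply: eq_bigr => k _.
by rewrite quad_form_sum; under eq_bigr do rewrite hgamma.
Qed.

Lemma vec_ip_lin_comb f (q : 'I_nu.+1 -> D -> R) (c : 'I_nu.+1 -> R) :
  (forall j, carrier E (f j)) -> (forall k, carrier E (q k)) ->
  vec_ip E f (\sum_k (c k \*o q k)) = \sum_k c k *: vec_ip E f (q k).
Proof.
move=> Ef Eq; apply/matrixP => j z; rewrite summxE mxE ip_lin_combr //.
by apply: eq_bigr => k _; rewrite !mxE.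
Qed.

Lemma gram_bound_recombine p q c P f chi :
  (forall k, carrier E (p k)) -> (forall j, carrier E (f j)) ->
  (forall k, q k = \sum_j (c k j \*o p j)) ->
  gram_bound p (recombine c P) f chi = gram_bound q P f chi.
Proof.
move=> Ep Ef hq; rewrite /gram_bound; congr (- _ - _ *+ 2).
- pose g k l := (chi^T *m Zm P k l *m chi) 0 0.
  pose F j m k l := ip E (p j) (p m) * (c k j * c l m * g k l).
  (* Both sides expand to this fourfold sum: the coefficients c sit in the free matrices on the left
     and, by bilinearity, in <q_k, q_l> on the right. *)
  transitivity (\sum_j \sum_m \sum_k \sum_l F j m k l).
    apply: eq_bigr => j _; apply: eq_bigr => m _ /=.
    rewrite mulmx_sumr mulmx_suml summxE mulr_sumr; apply: eq_bigr => k _.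
    by rewrite quad_form_sum mulr_sumr.
  under eq_bigr do rewrite exchange_big /=.
  rewrite exchange_big /=; apply: eq_bigr => k _.
  under eq_bigr do rewrite exchange_big /=.
  rewrite exchange_big /=; apply: eq_bigr => l _.
  rewrite !hq ip_lin_combl //; last exact: carrier_lin_comb.
  rewrite mulr_suml; apply: eq_bigr => j _.
  rewrite ip_lin_combr // mulr_sumr mulr_suml.
  by rewrite -/(g k l); apply: eq_bigr => m _; rewrite /F; ring.
- under [RHS]eq_bigr => k _ do rewrite hq vec_ip_lin_comb // mulmx_sumr summxE.
  rewrite [RHS]exchange_big /=; apply: eq_bigr => j _.
  rewrite mulmx_sumr mulmx_suml summxE; apply: eq_bigr => k _.
  by rewrite -scalemxAr -scalemxAl -scalemxAr.
Qed.

(** Pairing [compress W P chi] with the Gram matrix of (q_0, ..., q_nu, f_1, ..., f_n) gives the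
    difference of the two sides. *)
Lemma gram_bound_le q P f chi :
  pos_semidef (Psi W P) ->
  (forall k, carrier E (q k)) -> (forall j, carrier E (f j)) ->
  gram_bound q P f chi <= weighted_sqnorm E W f.
Proof.
move=> P_psd Eq Ef.
pose x (a : 'I_(nu.+1 + n)) : D -> R :=
  match fintype.split a with inl k => q k | inr j => f j end.
have Ex a : carrier E (x a) by rewrite /x; case: fintype.split.
have xl k : x (lshift n k) = q k by rewrite /x (unsplitK (inl k)).
have xr j : x (rshift nu.+1 j) = f j by rewrite /x (unsplitK (inr j)).
have := psd_gram_ge0 (pos_semidef_compress chi P_psd) Ex.
rewrite big_split_ord /=.
have linE k : (chi^T *m Nm P k *m vec_ip E f (q k)) 0 0
              = \sum_j (chi^T *m Nm P k) 0 j * ip E (f j) (q k).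
  by rewrite mxE; apply: eq_bigr => j _; rewrite [X in _ * X]mxE.
(* The upper rows give the Z part and one copy of the cross term; the lower rows give the second
   copy and <f, W f>. *)
have -> : \sum_k \sum_b compress W P chi (lshift n k) b
              * ip E (x (lshift n k)) (x b)
  = \sum_k \sum_l ip E (q k) (q l) * (chi^T *m Zm P k l *m chi) 0 0
    + \sum_k (chi^T *m Nm P k *m vec_ip E f (q k)) 0 0.
  rewrite -big_split; apply: eq_bigr => k _ /=.
  rewrite big_split_ord /= linE; congr (_ + _); apply: eq_bigr => b _.
    by rewrite block_mxEul mxE !xl mulrC.
  by rewrite block_mxEur mxE xl xr ip_sym.
have -> : \sum_j \sum_b compress W P chi (rshift nu.+1 j) b
              * ip E (x (rshift nu.+1 j)) (x b)
  = \sum_k (chi^T *m Nm P k *m vec_ip E f (q k)) 0 0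
    + weighted_sqnorm E W f.
  under [X in X + _]eq_bigr do rewrite linE.
  rewrite [X in X + _]exchange_big /weighted_sqnorm -big_split; apply: eq_bigr => j _ /=.
  rewrite big_split_ord /= ip_lin_combr //; congr (_ + _).
    by apply: eq_bigr => k _; rewrite block_mxEdl mxE xl xr.
  by apply: eq_bigr => k _; rewrite block_mxEdr !xr.
by rewrite /gram_bound; lra.
Qed.

End GramBound.

(** * Change of spanning system and the equivalence *)

Lemma lin_span_mem (R : realType) (D : set R) m (q : 'I_m -> D -> R) k :
  lin_span q (q k).
Proof.
exists (fun j => (j == k)%:R); apply/funext => t; rewrite fct_sumE.
rewrite (bigD1 k) //= eqxx mul1r big1 ?addr0 // => j /negPf njk.
by rewrite njk mul0r.
Qed.

Lemma lin_span_coeffs (R : realType) (D : set R) m m'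
    (p : 'I_m -> D -> R) (q : 'I_m' -> D -> R) :
  lin_span q `<=` lin_span p ->
  exists c, forall k, q k = \sum_j (c k j \*o p j).
Proof.
move=> qp; have qE k : exists c, q k = \sum_j (c j \*o p j).
  exact: qp (lin_span_mem q k).
by have [c hc] := choice qE; exists c.
Qed.

Theorem theorem5 (R : realType) (D : 'I_3 -> set R)
  (hdisj : D 1 `&` D 2 = set0) (hD : D 1 `|` D 2 = D 0)
  (E : forall i : 'I_3, euclidean_function_space (D i))
  (hrestr : forall i : 'I_3, i = 1 \/ i = 2 ->
     forall phi, carrier (E 0) phi -> carrier (E i) (restrict_fun (dom_sub hD (i := i)) phi))
  (hip : forall phi psi, carrier (E 0) phi -> carrier (E 0) psi ->
     ip (E 0) phi psi
     = ip (E 1) (restrict_fun (dom_sub hD (i := 1)) phi)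
                (restrict_fun (dom_sub hD (i := 1)) psi)
       + ip (E 2) (restrict_fun (dom_sub hD (i := 2)) phi)
                  (restrict_fun (dom_sub hD (i := 2)) psi))
  (nu n : nat) (hn : (1 <= n)%N)
  (W : 'M[R]_n) (hW : pos_def W)
  (i : 'I_3) (hi : i = 1 \/ i = 2)
  (Pi : 'I_nu.+1 -> D i -> R)
  (hPiE : forall k, carrier (E i) (Pi k)) (hPi0 : Pi ord0 = cst 1)
  (hPi : orthogonal_system (E i) Pi)
  (p : 'I_nu.+1 -> D i -> R)
  (hpE : forall k, carrier (E i) (p k)) (hp : lin_indep p)
  (hspan : lin_span p = lin_span Pi)
  (rho : 'I_nu.+1 -> R)
  (hrho : forall k, rho k = ip_norm (E i) (Pi k) ^+ 2)
  (gamma : 'I_nu.+1 -> 'I_nu.+1 -> R)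
  (hgamma : forall k l, gamma k l = ip (E i) (p k) (p l)) :
  let S := restrictions (dom_sub hD (i := i)) (E 0) (n := n) in
  let GFMB := gfmb_bound (E i) Pi rho in
  let IFB_GFMB := ifb_gfmb_bound (E i) p gamma in
  [/\ lower_estimation (E i) W S GFMB,
      lower_estimation (E i) W S IFB_GFMB
    & equivalent_estimations W S GFMB IFB_GFMB].
Proof.
move=> S GFMB IFB_GFMB.
have SE f : S f -> forall j, carrier (E i) (f j).
  by move=> [g [Eg ->]] j; exact: hrestr.
have GE P f chi : GFMB P f chi = gram_bound (E i) Pi P f chi.
  exact: gfmb_bound_gram.
have IE P f chi : pos_semidef (Psi W P) ->
    IFB_GFMB P f chi = gram_bound (E i) p P f chi.
  by move=> P_psd; exact: ifb_gfmb_bound_gram P_psd hpE hgamma.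
split.
- by move=> P P_psd f chi /SE Ef; rewrite GE gram_bound_le.
- by move=> P P_psd f chi /SE Ef; rewrite IE // gram_bound_le.
split=> P P_psd.
(* The matrix c depends only on the two systems, so the new free matrices are fixed before f and
   chi. *)
- have [c hc] : exists c, forall k, Pi k = \sum_j (c k j \*o p j).
    by apply: lin_span_coeffs; rewrite hspan.
  (* [P'_psd] serves both as admissibility and as the premise of [IE] for the recombined
     matrices. *)
  exists (recombine c P); have P'_psd := pos_semidef_recombine c P_psd.
  by split=> // f chi /SE Ef; rewrite IE // GE; exact: gram_bound_recombine.
- have [c hc] : exists c, forall k, p k = \sum_j (c k j \*o Pi j).
    by apply: lin_span_coeffs; rewrite hspan.
  exists (recombine c P); have P'_psd := pos_semidef_recombine c P_psd.
  by split=> // f chi /SE Ef; rewrite GE IE //; exact: gram_bound_recombine.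
Qed.
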